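(* For every integer $l \ge 2$, the resolving total domination numbers of the fractal cubic networks satisfy $\gamma_{rt}(FCN(l)) = 4\,\gamma_{rt}(FCN(l-1))$.
   Context: Fractal cubic network: for an integer $l\ge 0$, $FCN(l)$ is the finite simple graph whose vertices are all binary strings of length $2l+2$, defined recursively as follows. $FCN(0)$ is the 4-cycle with vertices $00, 01, 11, 10$ in this cyclic order. For $l\ge 1$, $FCN(l)$ is obtained from the disjoint union of the four copies $ab\,\Vert\,FCN(l-1)$, $a,b\in\{0,1\}$ (each vertex string of $FCN(l-1)$ is prefixed by $ab$, adjacency inside a copy being that of $FCN(l-1)$), by adding the four edges $\{00w,10w\}$, $\{10w,11w\}$, $\{11w,01w\}$, $\{01w,00w\}$, where $w=10(01)^{l-1}$ is the string $10$ followed by $l-1$ repetitions of $01$. A set $R\subseteq V(\Gamma)$ of a connected graph $\Gamma$ is a resolving set if for every two distinct vertices $g,h$ there is $r\in R$ with $d(g,r)\ne d(h,r)$ (graph distance). A total dominating set is a set $D\subseteq V(\Gamma)$ such that every vertex of $\Gamma$ (including those in $D$) is adjacent to some vertex of $D$. A resolving total dominating set is a set that is both a resolving set and a total dominating set; $\gamma_{rt}(\Gamma)$ is the minimum size of such a set. *)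

(* Defs.v *)
From mathcomp Require Import all_boot.

Set Implicit Arguments.
Unset Strict Implicit.
Unset Printing Implicit Defensive.

Section Graph.
Variables (T : finType) (e : rel T).

Definition has_walk (x y : T) (n : nat) : bool :=
  [exists p : n.-tuple T, path e x p && (last x p == y)].

(* Least length of a walk from x to y: shortest walks have length < #|T|, and
   the value is #|T| when y cannot be reached from x (see gdistP). *)
Definition gdist (x y : T) : nat := find (has_walk x y) (iota 0 #|T|).

Definition resolving (R : {set T}) : bool :=
  [forall g, forall h, (g != h) ==> [exists r in R, gdist g r != gdist h r]].

Definition total_dominating (D : {set T}) : bool :=
  [forall x, exists y in D, e x y].

Definition resolving_total_dominating (D : {set T}) : bool :=
  resolving D && total_dominating D.

(* The default setT is itself such a set when no vertex is isolated
   (see rtd_setT), so this is then the true minimum. *)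
Definition gamma_rt : nat :=
  #|[arg min_(D < [set: T] | resolving_total_dominating D) #|D|]|.

Lemma has_walkP x y n :
  reflect (exists p, [/\ path e x p, last x p = y & size p = n])
          (has_walk x y n).
Proof.
apply: (iffP existsP) => [[p /andP[ep /eqP lp]]|[p [ep lp /eqP sp]]].
  by exists p; rewrite size_tuple.
by exists (Tuple sp); rewrite /= ep lp /=.
Qed.

Lemma gdistP x y : connect e x y ->
  has_walk x y (gdist x y) /\ forall n, has_walk x y n -> gdist x y <= n.
Proof.
case/connectP=> p ep lp.
have lt_walk m : has_walk x y m ->
  exists k, [/\ has_walk x y k, k <= m & k < #|T|].
  case/has_walkP=> q [eq lq <-].
  move: lq; case: (shortenP eq) => q' eq' uq' sub lq'.
  exists (size q'); split.
  - by apply/has_walkP; exists q'.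
  - by apply: (uniq_leq_size _ sub); case/andP: uq'.
  - by rewrite -[(size q').+1]/(size (x :: q')) -(card_uniqP uq') max_card.
have hs : has (has_walk x y) (iota 0 #|T|).
  have [|k [wk _ ltk]] := lt_walk (size p); first by apply/has_walkP; exists p.
  by apply/hasP; exists k; rewrite // mem_iota.
have lt_d : gdist x y < #|T| by rewrite /gdist -[X in _ < X](size_iota 0) -has_find.
split.
  by have := nth_find 0 hs; rewrite -/(gdist x y) nth_iota.
move=> n /lt_walk[k [wk le_kn ltk]]; apply: leq_trans le_kn.
rewrite leqNgt; apply/negP => /(before_find 0).
by rewrite nth_iota // add0n wk.
Qed.

Lemma gdist_eq0 x y : (gdist x y == 0) = (x == y).
Proof.
have T_gt0 : 0 < #|T| by apply/card_gt0P; exists x.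
have w0 : has_walk x y 0 = (x == y).
  apply/has_walkP/eqP => [[p [_ <- /size0nil->]]//|->].
  by exists [::].
rewrite /gdist; case: #|T| T_gt0 => // m _ /=.
by rewrite w0; case: (x == y).
Qed.

Lemma rtd_setT :
  (forall x, exists y, e x y) -> resolving_total_dominating [set: T].
Proof.
move=> noiso; apply/andP; split.
  apply/forallP=> g; apply/forallP=> h; apply/implyP=> neq_gh.
  apply/existsP; exists g; rewrite inE /=.
  have /eqP-> : gdist g g == 0 by rewrite gdist_eq0.
  by rewrite eq_sym gdist_eq0 eq_sym.
apply/forallP=> x; have [y exy] := noiso x.
by apply/existsP; exists y; rewrite inE.
Qed.

End Graph.

(* Bit 0 is false and bit 1 is true. *)
Definition cycle_edges : seq (seq bool * seq bool) :=
  [:: ([:: false; false], [:: false; true]);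
      ([:: false; true],  [:: true; true]);
      ([:: true; true],   [:: true; false]);
      ([:: true; false],  [:: false; false])].

Definition cycle_adj (u v : seq bool) : bool :=
  ((u, v) \in cycle_edges) || ((v, u) \in cycle_edges).

(* The string w = 10(01)^k: the edges added in building level k.+1 from four
   copies of level k join abw and cdw for ab, cd adjacent in the 4-cycle
   00, 01, 11, 10. *)
Definition port (k : nat) : seq bool :=
  [:: true; false] ++ flatten (nseq k [:: false; true]).

(* Meaningful on strings u, v of length 2 * l + 2. *)
Fixpoint fcn_adj (l : nat) (u v : seq bool) : bool :=
  if l is k.+1 then
    (take 2 u == take 2 v) && fcn_adj k (drop 2 u) (drop 2 v)
    || [&& drop 2 u == port k, drop 2 v == port k
         & cycle_adj (take 2 u) (take 2 v)]
  else cycle_adj u v.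

Definition FCN_vertex (l : nat) : finType := (2 * l + 2).-tuple bool.

Definition FCN (l : nat) : rel (FCN_vertex l) := fun u v => fcn_adj l u v.

Arguments FCN l : clear implicits.

Lemma cycle_adj_sym u v : cycle_adj u v = cycle_adj v u.
Proof. by rewrite /cycle_adj orbC. Qed.

Lemma cycle_adj_irr u : cycle_adj u u = false.
Proof.
rewrite /cycle_adj orbb; apply/negP.
by rewrite !inE !xpair_eqE => /or4P[] /andP[/eqP->].
Qed.

Lemma FCN_sym l : symmetric (FCN l).
Proof.
move=> u v; rewrite /FCN; move: (val u) (val v) => {u v}.
elim: l => [|k IHk] u v /=; first exact: cycle_adj_sym.
by rewrite IHk eq_sym cycle_adj_sym; congr orb; rewrite andbCA.
Qed.

Lemma FCN_irr l : irreflexive (FCN l).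
Proof.
move=> u; rewrite /FCN; move: (val u) => {}u.
elim: l u => [|k IHk] u /=; first exact: cycle_adj_irr.
by rewrite IHk cycle_adj_irr !andbF.
Qed.

Lemma FCN_noiso l (u : FCN_vertex l) : exists v, FCN l u v.
Proof.
suff [v sv uv] : exists2 v, size v == 2 * l + 2 & fcn_adj l u v.
  by exists (Tuple sv).
have : size u = 2 * l + 2 by rewrite size_tuple.
move: (val u) => {}u; elim: l u => [|k IHk] u su.
  case: u su => [|a [|b []]] //= _.
  by exists [:: b; ~~ a] => //; case: a; case: b.
have s2 : size (take 2 u) = 2 by rewrite size_takel // su addnC.
have [|v sv uv] := IHk (drop 2 u); first by rewrite size_drop su mulnS -addnA addKn.
exists (take 2 u ++ v); first by rewrite size_cat s2 (eqP sv) mulnS addnA.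
by rewrite /= take_size_cat // drop_size_cat // eqxx uv.
Qed.

Lemma rtd_FCN_setT l :
  resolving_total_dominating (FCN l) [set: FCN_vertex l].
Proof. exact/rtd_setT/FCN_noiso. Qed.

Lemma size_port k : size (port k) == 2 * k + 2.
Proof.
by rewrite size_cat size_flatten /shape map_nseq sumn_nseq /= addnC.
Qed.

Lemma FCN_connected l (u v : FCN_vertex l) : connect (FCN l) u v.
Proof.
elim: l u v => [|k IHk].
  have step (u : FCN_vertex 0) : exists2 a, val u = [:: a.1; a.2]
      & forall b, connect (FCN 0) u [tuple b.1; b.2].
    case: u => [[|a [|b []]] //= su]; exists (a, b) => // -[c d] /=.
    pose t : FCN_vertex 0 := [tuple c; b].
    apply: (@connect_trans _ _ t).
      have [eq_ca|neq_ca] := eqVneq c a.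
        by rewrite (_ : Tuple _ = t) ?connect0 //; apply: val_inj; rewrite /= eq_ca.
      by apply: connect1; rewrite /FCN /=; case: a c b neq_ca {su t} => [] [] [].
    have [eq_db|neq_db] := eqVneq d b.
      by rewrite (_ : t = [tuple c; d]) ?connect0 //; apply: val_inj; rewrite /= eq_db.
    by apply: connect1; rewrite /FCN /=; case: b d c neq_db {su t} => [] [] [].
  move=> u v; have [_ _ /(_ _) cu] := step u; have [b vb _] := step v.
  by rewrite (_ : v = [tuple b.1; b.2]) //; apply: val_inj.
pose n := 2 * k.+1 + 2.
have sz (a : 2.-tuple bool) (u : FCN_vertex k) : size (a ++ u) == n.
  by rewrite size_cat !size_tuple /n mulnS addnA.
pose pre a u : FCN_vertex k.+1 := Tuple (sz a u).
have pre_connect a u v : connect (FCN k.+1) (pre a u) (pre a v).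
  case/connectP: (IHk u v) => p; elim: p u => [|w p IHp] u /=.
    by move=> _ ->; apply: connect0.
  case/andP=> uw wp /(IHp _ wp); apply: connect_trans; apply: connect1.
  rewrite /FCN /= !take_size_cat ?drop_size_cat ?size_tuple // eqxx.
  by move: uw; rewrite /FCN => ->.
pose w : FCN_vertex k := Tuple (size_port k).
have cyc_connect (a b : 2.-tuple bool) : cycle_adj a b -> connect (FCN k.+1) (pre a w) (pre b w).
  move=> ab; apply: connect1; rewrite /FCN /=.
  by rewrite !take_size_cat ?drop_size_cat ?size_tuple // !eqxx ab orbT.
have port_connect a b : connect (FCN k.+1) (pre a w) (pre b w).
  have: exists c : 2.-tuple bool, (val a == val c) || cycle_adj a c /\
          ((val c == val b) || cycle_adj c b).
    case: a b => [[|a1 [|a2 []]] //= sa] [[|b1 [|b2 []]] //= sb].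
    by exists [tuple b1; a2]; case: a1 a2 b1 b2 {sa sb} => [] [] [] [].
  have eq_or (c d : 2.-tuple bool) : (val c == val d) || cycle_adj c d ->
      connect (FCN k.+1) (pre c w) (pre d w).
    by case/orP=> [/eqP/val_inj->|/cyc_connect //]; apply: connect0.
  by case=> c [/eq_or ac /eq_or]; apply: connect_trans.
have preE u : exists a u', u = pre a u'.
  have sa : size (take 2 u) == 2.
    by rewrite size_takel // size_tuple addnC.
  have su : size (drop 2 u) == 2 * k + 2.
    by rewrite size_drop size_tuple mulnS -addnA addKn.
  by exists (Tuple sa), (Tuple su); apply: val_inj; rewrite /= cat_take_drop.
move=> u v; have [a [u' ->]] := preE u; have [b [v' ->]] := preE v.
apply: connect_trans (pre_connect a u' w) _.
exact: connect_trans (port_connect a b) (pre_connect b w v').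
Qed.

(* Main.v *)
(* The graph is a cactus of 4-cycles, and gamma_rt (FCN l) = 2 * 4 ^ l for all l.
   Complementing the last two bits of a vertex pairs up the vertices; a
   resolving total dominating set meets each pair {u, u'}, which gives the
   lower bound: p00 and p11 are twins of degree 2, so one of them is in the
   set, and their only neighbours are p01 and p10, so one of these is too.
   For the upper bound, four copies of a set that works at one level work at
   the next.  If vertices au and bv of distinct copies are not resolved by ar
   and br, then comparing distances through the port w gives
   d(u, w) > d(v, w) > d(u, w). *)
Require Import Defs.
From mathcomp Require Import all_boot.

Set Implicit Arguments.
Unset Strict Implicit.
Unset Printing Implicit Defensive.

(** * Distances, twins and the minimum in an arbitrary graph *)

Section GraphDistance.
Variables (T : finType) (e : rel T).

Lemma gdistxx x : gdist e x x = 0.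
Proof. by apply/eqP; rewrite gdist_eq0. Qed.

Lemma gdist_le x y p : path e x p -> last x p = y -> gdist e x y <= size p.
Proof.
move=> ep lp; have [|_] := @gdistP _ e x y; first by apply/connectP; exists p.
by apply; apply/has_walkP; exists p.
Qed.

Lemma gdist_walk x y : connect e x y ->
  exists p, [/\ path e x p, last x p = y & size p = gdist e x y].
Proof. by case/gdistP=> /has_walkP. Qed.

(** Source of all lower bounds on distances below: [f] drops by at most one along each step of a
    shortest walk, so a well-chosen [f] forces the walk to be long. *)
Lemma gdist_lipschitz (f : T -> nat) x y :
    (forall u v, e u v -> f u <= (f v).+1) -> connect e x y ->
  f x <= gdist e x y + f y.
Proof.
move=> f_lip /gdist_walk[p [ep lp <-]].
elim: p x ep lp => [|z p IHp] x /= => [_ -> //|/andP[xz zp] lp].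
by apply: leq_trans (f_lip _ _ xz) _; rewrite addSn ltnS IHp.
Qed.

Lemma gdist_edge x y z : connect e y z -> e x y ->
  gdist e x z <= (gdist e y z).+1.
Proof.
by move=> /gdist_walk[p [yp lp <-]] xy; apply: (@gdist_le _ _ (y :: p)); rewrite /= ?xy.
Qed.

Lemma gdist1_adj x y : connect e x y -> gdist e x y = 1 -> e x y.
Proof.
case/gdist_walk=> p [xp lp <-]; case: p xp lp => [|z []] //=.
by rewrite andbT => xz <-.
Qed.

(** A shortest walk from [y] to [z] has a first step because [y != z], and [x] can take the same
    step. *)
Lemma gdist_twin_le x y z : (forall v, e x v = e y v) -> y != z ->
  connect e y z -> gdist e x z <= gdist e y z.
Proof.
move=> twin neq_yz /gdist_walk[p [yp lp <-]]; case: p yp lp => [_ /=|v p /= yp lp].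
  by move/eqP; rewrite (negPf neq_yz).
by apply: (@gdist_le _ _ (v :: p)); rewrite //= twin.
Qed.

(** Twins are equidistant from every third vertex, so only one of the two can tell them apart. *)
Lemma resolving_twin (R : {set T}) x y :
    (forall u v, connect e u v) -> resolving e R -> (forall v, e x v = e y v) ->
  x != y -> (x \in R) || (y \in R).
Proof.
move=> conn /forallP/(_ x)/forallP/(_ y)/implyP res twin /res/existsP[r /andP[Rr]].
have [->|neq_xr] := eqVneq x r; first by rewrite Rr.
have [->|neq_yr] := eqVneq y r; first by rewrite Rr orbT.
by rewrite eqn_leq !gdist_twin_le.
Qed.

Lemma gamma_rt_le (D : {set T}) :
  resolving_total_dominating e D -> gamma_rt e <= #|D|.
Proof.
(* [arg_min] is meaningful only if its default [setT] is admissible; total domination by [D]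
   excludes isolated vertices, which suffices. *)
move=> rtD; have rtT : resolving_total_dominating e [set: T].
  apply: rtd_setT => x; have /andP[_ /forallP/(_ x)/existsP[y]] := rtD.
  by case/andP=> _; exists y.
by rewrite /gamma_rt; case: arg_minnP => // A _; apply.
Qed.

Lemma gamma_rt_witness : (forall x, exists y, e x y) ->
  exists2 D, resolving_total_dominating e D & gamma_rt e = #|D|.
Proof.
move=> noiso; have := rtd_setT noiso; rewrite /gamma_rt => rtT.
by case: arg_minnP => // A rtA _; exists A.
Qed.

End GraphDistance.

(** * Lower bound: pairing vertices by their last two bits *)

Fixpoint flip_last2 l (u : seq bool) : seq bool :=
  if l is k.+1 then take 2 u ++ flip_last2 k (drop 2 u) else map negb u.

(* Vertices ending in 00 or 11 are never ports, so they have degree 2. *)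
Fixpoint leaf l (u : seq bool) : bool :=
  if l is k.+1 then leaf k (drop 2 u)
  else (u == [:: false; false]) || (u == [:: true; true]).

(** The corner 00 of the innermost 4-cycle that contains [u]. *)
Fixpoint block_leaf l (u : seq bool) : seq bool :=
  if l is k.+1 then take 2 u ++ block_leaf k (drop 2 u) else [:: false; false].

Lemma size_seqS l (u : seq bool) : size u = 2 * l.+1 + 2 ->
  size (take 2 u) = 2 /\ size (drop 2 u) = 2 * l + 2.
Proof.
by move=> su; rewrite size_drop size_takel su // mulnS -addnA ?addKn.
Qed.

Lemma size_seq0 (u : seq bool) : size u = 2 * 0 + 2 -> exists a b, u = [:: a; b].
Proof. by case: u => [|a [|b []]] // _; exists a, b. Qed.

Lemma size_flip_last2 l u : size u = 2 * l + 2 -> size (flip_last2 l u) = 2 * l + 2.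
Proof.
elim: l u => [|k IHk] u su /=; first by rewrite size_map.
by have [s2 sd] := size_seqS su; rewrite size_cat s2 IHk // mulnS addnA.
Qed.

Lemma flip_last2K l u : size u = 2 * l + 2 -> flip_last2 l (flip_last2 l u) = u.
Proof.
elim: l u => [|k IHk] u su /=; first by rewrite (mapK negbK).
have [s2 sd] := size_seqS su.
by rewrite take_size_cat // drop_size_cat // IHk // cat_take_drop.
Qed.

Lemma flip_last2_neq l u : size u = 2 * l + 2 -> u != flip_last2 l u.
Proof.
elim: l u => [|k IHk] u su /=; first by case: u su => [|[] u].
have [s2 sd] := size_seqS su.
by rewrite -{1}(cat_take_drop 2 u) eqseq_cat // eqxx IHk.
Qed.

Lemma leaf_flip l u : size u = 2 * l + 2 -> leaf l (flip_last2 l u) = leaf l u.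
Proof.
elim: l u => [|k IHk] u su /=; first by have [[] [[] ->]] := size_seq0 su.
by have [s2 sd] := size_seqS su; rewrite drop_size_cat // IHk.
Qed.

Lemma size_block_leaf l u : size u = 2 * l + 2 -> size (block_leaf l u) = 2 * l + 2.
Proof.
elim: l u => [|k IHk] u su //=.
by have [s2 sd] := size_seqS su; rewrite size_cat s2 IHk // mulnS addnA.
Qed.

Lemma leaf_block_leaf l u : size u = 2 * l + 2 -> leaf l (block_leaf l u).
Proof.
elim: l u => [|k IHk] u su //=.
by have [s2 sd] := size_seqS su; rewrite drop_size_cat // IHk.
Qed.

(** The last two bits of a port are 10 at level 0 and 01 above. *)
Lemma leaf_port l : leaf l (port l) = false.
Proof.
case: l => [|l] //; rewrite [LHS]/=.
by elim: l => [|l IHl] //; rewrite -[RHS]IHl.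
Qed.

Lemma leaf_neq_port l u : leaf l u -> (u == port l) = false.
Proof. by move=> lu; apply/eqP => eu; rewrite eu leaf_port in lu. Qed.

(** Opposite corners of a 4-cycle have the same neighbours in it, and since leaves are never ports,
    no later level adds an edge at either. *)
Lemma flip_twin l u v : size u = 2 * l + 2 -> size v = 2 * l + 2 -> leaf l u ->
  fcn_adj l u v = fcn_adj l (flip_last2 l u) v.
Proof.
elim: l u v => [|k IHk] u v su sv /=.
  by have [[] [[] ->]] := size_seq0 su; have [[] [[] ->]] := size_seq0 sv.
have [s2 sd] := size_seqS su; have [t2 td] := size_seqS sv => lu.
rewrite take_size_cat // drop_size_cat // -IHk //.
have lf : leaf k (flip_last2 k (drop 2 u)) by rewrite leaf_flip.
by rewrite (leaf_neq_port lu) (leaf_neq_port lf).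
Qed.

(** The corner 00 keeps only its neighbours 01 and 10 in its 4-cycle; when [u] is not a leaf, these
    are [u] and its flip. *)
Lemma block_leaf_adj l u v : size u = 2 * l + 2 -> size v = 2 * l + 2 ->
  ~~ leaf l u -> fcn_adj l (block_leaf l u) v -> v = u \/ v = flip_last2 l u.
Proof.
elim: l u v => [|k IHk] u v su sv /=.
  have [[] [[] ->]] := size_seq0 su; have [[] [[] ->]] := size_seq0 sv => //= _ _;
    by [left | right].
have [s2 sd] := size_seqS su; have [t2 td] := size_seqS sv => lu.
rewrite take_size_cat // drop_size_cat // (leaf_neq_port (leaf_block_leaf sd)) orbF.
case/andP=> /eqP eq_uv /(IHk _ _ sd td lu) eq_d.
rewrite -(cat_take_drop 2 v) -{1}(cat_take_drop 2 u) -eq_uv.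
by case: eq_d => ->; [left | right].
Qed.

Lemma rtd_FCN_card l (D : {set FCN_vertex l}) :
  resolving_total_dominating (FCN l) D -> 2 * 4 ^ l <= #|D|.
Proof.
case/andP=> res dom.
have sz_flip (u : FCN_vertex l) : size (flip_last2 l u) == 2 * l + 2.
  by rewrite size_flip_last2 ?size_tuple.
pose fl u : FCN_vertex l := Tuple (sz_flip u).
have flK : involutive fl by move=> u; apply: val_inj; rewrite /= flip_last2K ?size_tuple.
have meet u : (u \in D) || (fl u \in D).
  have su := size_tuple u.
  have [lu|lu] := boolP (leaf l u).
    apply: (resolving_twin (@FCN_connected l) res); last exact: (flip_last2_neq su).
    by move=> v; rewrite /FCN flip_twin // size_tuple.
  have sz : size (block_leaf l u) == 2 * l + 2 by rewrite size_block_leaf.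
  have /existsP[v /andP[Dv]] := forallP dom (Tuple sz).
  case/(block_leaf_adj su (size_tuple v) lu) => uv; last first.
    by rewrite (_ : fl u = v) ?Dv ?orbT //; apply: val_inj.
  by rewrite (_ : u = v) ?Dv //; apply: val_inj.
(* [D] and its preimage under the involution have equal size and cover all 2^(2l+2) vertices. *)
have: #|[set: FCN_vertex l]| <= #|D :|: fl @^-1: D|.
  by apply/subset_leq_card/subsetP => u _; rewrite !inE meet.
rewrite cardsT card_tuple card_bool => leD.
have := leq_trans leD (leq_card_setU D (fl @^-1: D)).
rewrite card_preimset ?addnn; last exact: inv_inj flK.
by rewrite expnD expnM mulnC -[2 ^ 2]/(2 * 2) -mulnA -[_.*2]mul2n leq_pmul2l.
Qed.

(** * Upper bound: four copies of the previous level *)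

Section Copies.
Variable k : nat.
Implicit Types (x y z : FCN_vertex k.+1) (u v r : FCN_vertex k) (a b : 2.-tuple bool).

Let portv : FCN_vertex k := Tuple (size_port k).

Lemma size_copy x : size (take 2 x) == 2.
Proof. by have [-> _] := size_seqS (size_tuple x). Qed.

Lemma size_inner x : size (drop 2 x) == 2 * k + 2.
Proof. by have [_ ->] := size_seqS (size_tuple x). Qed.

Lemma size_prefix a u : size (a ++ u) == 2 * k.+1 + 2.
Proof. by rewrite size_cat !size_tuple mulnS addnA. Qed.

Definition copy x : 2.-tuple bool := Tuple (size_copy x).
Definition inner x : FCN_vertex k := Tuple (size_inner x).
Definition prefix_vertex a u : FCN_vertex k.+1 := Tuple (size_prefix a u).

Lemma prefixK x : prefix_vertex (copy x) (inner x) = x.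
Proof. by apply: val_inj; rewrite /= cat_take_drop. Qed.

Lemma copy_prefix a u : copy (prefix_vertex a u) = a.
Proof. by apply: val_inj; rewrite /= take_size_cat ?size_tuple. Qed.

Lemma inner_prefix a u : inner (prefix_vertex a u) = u.
Proof. by apply: val_inj; rewrite /= drop_size_cat ?size_tuple. Qed.

Lemma FCN_S x y : FCN k.+1 x y =
  (copy x == copy y) && FCN k (inner x) (inner y)
  || [&& inner x == portv, inner y == portv & cycle_adj (copy x) (copy y)].
Proof. by []. Qed.

Lemma FCN_prefix a u v :
  FCN k u v -> FCN k.+1 (prefix_vertex a u) (prefix_vertex a v).
Proof. by move=> uv; rewrite FCN_S !copy_prefix !inner_prefix eqxx uv. Qed.

Let d := gdist (FCN k).
Let d' := gdist (FCN k.+1).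

Let dS u v r : FCN k u v -> d u r <= (d v r).+1.
Proof. exact/gdist_edge/FCN_connected. Qed.

Let d_triangle u v r : d u r <= d u v + d v r.
Proof.
apply: (@gdist_lipschitz _ _ (d^~ r)); last exact: FCN_connected.
by move=> *; apply: dS.
Qed.

(* The right-hand side uses the retraction of the graph onto copy a that
   sends the other copies to the port. *)
Lemma gdist_same_copy a u r :
  d' (prefix_vertex a u) (prefix_vertex a r) = d u r.
Proof.
apply/eqP; rewrite eqn_leq; apply/andP; split.
  pose f v := d' (prefix_vertex a v) (prefix_vertex a r).
  have := @gdist_lipschitz _ (FCN k) f u r; rewrite /f /d' gdistxx addn0; apply.
    by move=> v v' /(FCN_prefix a); apply/gdist_edge/FCN_connected.
  exact: FCN_connected.
pose f x := d (if copy x == a then inner x else portv) r.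
have := @gdist_lipschitz _ (FCN k.+1) f (prefix_vertex a u) (prefix_vertex a r).
rewrite /f !copy_prefix !inner_prefix eqxx [d r r]gdistxx addn0; apply; last first.
  exact: FCN_connected.
move=> x y; rewrite FCN_S => /orP[/andP[/eqP<- xy]|/and3P[/eqP-> /eqP-> _]].
  by case: ifP => // _; apply: dS.
by rewrite !if_same.
Qed.

Lemma gdist_other_copy a b v r : a != b ->
  d v portv + d portv r < d' (prefix_vertex b v) (prefix_vertex a r).
Proof.
move=> neq_ab.
(* An underestimate of the distance to [ar]: go to the port in copy [b], cross at least one added
   edge, then go from the port to [r]. The other two copies are collapsed to their ports. *)
pose f x := if copy x == a then d (inner x) r else
  ((if copy x == b then d (inner x) portv else 0) + d portv r).+1.
have d0 u : d u u = 0 by apply: gdistxx.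
have := @gdist_lipschitz _ (FCN k.+1) f (prefix_vertex b v) (prefix_vertex a r).
rewrite /f !copy_prefix !inner_prefix !eqxx eq_sym (negPf neq_ab) d0 addn0; apply.
  move=> x y; rewrite FCN_S => /orP[/andP[/eqP<- xy]|/and3P[/eqP-> /eqP-> _]].
    case: ifP => _; first exact: dS.
    by case: ifP => _; rewrite ltnS // -addSn leq_add2r dS.
  (* At a port, [f] is [d portv r] in copy [a] and one more elsewhere. *)
  by rewrite d0 !if_same add0n; do 2![case: ifP => _ //]; apply: leqW.
exact: FCN_connected.
Qed.

Definition copies (D : {set FCN_vertex k}) : {set FCN_vertex k.+1} :=
  [set x | inner x \in D].

Lemma prefix_copies D a u : (prefix_vertex a u \in copies D) = (u \in D).
Proof. by rewrite inE inner_prefix. Qed.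

Lemma card_copies D : #|copies D| <= 4 * #|D|.
Proof.
have -> : 4 * #|D| = #|setX [set: 2.-tuple bool] D|.
  by rewrite cardsX cardsT card_tuple card_bool.
apply: leq_trans (leq_imset_card (fun p => prefix_vertex p.1 p.2) _).
apply/subset_leq_card/subsetP => x; rewrite inE => Dx.
by apply/imsetP; exists (copy x, inner x); rewrite ?inE ?prefixK.
Qed.

Lemma rtd_copies D : resolving_total_dominating (FCN k) D ->
  resolving_total_dominating (FCN k.+1) (copies D).
Proof.
case/andP=> /forallP res /forallP dom; apply/andP; split; last first.
  apply/forallP=> x; have /existsP[v /andP[Dv xv]] := dom (inner x).
  apply/existsP; exists (prefix_vertex (copy x) v).
  by rewrite prefix_copies Dv -{1}(prefixK x) FCN_prefix.
apply/forallP=> x; apply/forallP=> y; apply/implyP.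
rewrite -(prefixK x) -(prefixK y); move: (copy x) (inner x) (copy y) (inner y).
move=> {x y} a u b v; have [<- neq_uv|neq_ab _] := eqVneq a b.
  have neq : u != v by apply: contraNneq neq_uv => ->.
  have /existsP[r /andP[Dr dr]] := implyP (forallP (res u) v) neq.
  apply/existsP; exists (prefix_vertex a r).
  by rewrite prefix_copies Dr [X in X != _]gdist_same_copy
             [X in _ != X]gdist_same_copy.
(* Any member of [D] will do here; domination provides one. *)
have /existsP[r /andP[Dr _]] := dom portv.
apply/contraT; rewrite negb_exists => /forallP none.
have deq c : d' (prefix_vertex a u) (prefix_vertex c r)
          = d' (prefix_vertex b v) (prefix_vertex c r).
  by have := none (prefix_vertex c r); rewrite prefix_copies Dr negbK => /eqP.
(* With w the port: d(v,w) + d(w,r) < d'(bv,ar) = d'(au,ar) = d(u,r) <= d(u,w) + d(w,r). The reverse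
   inequality uses [br] in the same way. *)
have lt_vu : d v portv < d u portv.
  rewrite -(ltn_add2r (d portv r)); apply: leq_trans (d_triangle _ _ _).
  by rewrite -(gdist_same_copy a u) deq gdist_other_copy.
have : d u portv < d v portv.
  rewrite -(ltn_add2r (d portv r)); apply: leq_trans (d_triangle _ _ _).
  by rewrite -(gdist_same_copy b v) -deq gdist_other_copy // eq_sym.
by rewrite ltnNge ltnW.
Qed.

End Copies.

(** * The 4-cycle and the closed formula *)

Lemma gamma_rt_FCN0_le : gamma_rt (FCN 0) <= 2.
Proof.
pose c00 : FCN_vertex 0 := [tuple false; false].
pose c10 : FCN_vertex 0 := [tuple true; false].
have <- : #|[set c00; c10]| = 2 by rewrite cards2.
apply: gamma_rt_le; apply/andP; split; last first.
  apply/forallP=> -[[|a [|b []]] //= sx]; apply/existsP.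
  by exists (if a == b then c10 else c00); rewrite !inE /FCN /=; case: a b {sx} => [] [].
apply/forallP=> x; apply/forallP=> y; apply/implyP=> neq_xy; apply/existsP.
have [Dx|Dx] := boolP (x \in [set c00; c10]).
  by exists x; rewrite Dx gdistxx eq_sym gdist_eq0 eq_sym.
have [Dy|Dy] := boolP (y \in [set c00; c10]).
  by exists y; rewrite Dy gdistxx gdist_eq0.
(* Only 01 and 11 remain, and just the first is adjacent to 00; by [adj1], adjacency to 00 can be
   read off the distance. *)
exists c00; rewrite !inE eqxx /=.
have adj1 z : z != c00 -> FCN 0 z c00 = (gdist (FCN 0) z c00 == 1).
  move=> nz; apply/idP/eqP => [zc|/gdist1_adj->] //; last exact: FCN_connected.
  apply/eqP; rewrite eqn_leq lt0n gdist_eq0 nz andbT.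
  by apply: (@gdist_le _ _ _ _ [:: c00]); rewrite /= ?zc.
move: Dx Dy; rewrite !inE !negb_or => /andP[x0 x1] /andP[y0 y1].
have : FCN 0 x c00 != FCN 0 y c00.
  move: neq_xy x0 x1 y0 y1; rewrite -!val_eqE /FCN.
  case: x => [[|a [|b []]] //= sx]; case: y => [[|a' [|b' []]] //= sy].
  by move: a b a' b' {sx sy} => [] [] [] [].
by rewrite !adj1 //; apply: contraNneq => ->.
Qed.

Lemma gamma_rt_FCN l : gamma_rt (FCN l) = 2 * 4 ^ l.
Proof.
apply/eqP; rewrite eqn_leq; apply/andP; split; last first.
  by have [D rtD ->] := gamma_rt_witness (@FCN_noiso l); apply: rtd_FCN_card.
elim: l => [|k IHk]; first exact: gamma_rt_FCN0_le.
have [D rtD eqD] := gamma_rt_witness (@FCN_noiso k).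
apply: leq_trans (gamma_rt_le (rtd_copies rtD)) _.
by apply: leq_trans (card_copies D) _; rewrite expnS mulnCA leq_pmul2l // -eqD.
Qed.

Theorem theorem29 (l : nat) (hl : 2 <= l) :
  gamma_rt (FCN l) = 4 * gamma_rt (FCN (l - 1)).
Proof.
by case: l hl => // k _; rewrite subn1 !gamma_rt_FCN expnS mulnCA.
Qed.
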